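(* Let $\Sigma$ be a signature. The ordered triple $(L_{\Sigma},\pi_{\mathrm{Isys}_{\Sigma}},K_{\Sigma})$ is a strong Lawvere adjoint cylinder.
   Context: A signature $\Sigma=(\Sigma_n)_{n\in\mathbb{N}}$ assigns to each $n\in\mathbb{N}$ a set $\Sigma_n$ of operation symbols of arity $n$. A $\Sigma$-algebra $\mathbf{A}=(A,F)$ is a set $A$ with an operation $F_\sigma\colon A^n\to A$ for each $n$ and each $\sigma\in\Sigma_n$; the empty algebra is allowed when $\Sigma_0=\varnothing$. Homomorphisms are the maps preserving all operations; $\mathsf{Alg}(\Sigma)$ is the resulting category. A sup-semilattice is an ordered set $\mathbf{I}=(I,\leq)$ in which any two elements $i,j$ have a least upper bound $i\vee j$; morphisms are the maps preserving $\vee$; $\mathsf{Ssl}$ is the resulting category. For a sup-semilattice $\mathbf{I}$, an $\mathbf{I}$-inductive system of $\Sigma$-algebras is a pair $\mathcal{A}=((\mathbf{A}_i)_{i\in I},(f_{i,j})_{i\leq j})$ with $\mathbf{A}_i$ a $\Sigma$-algebra, $f_{i,j}\colon\mathbf{A}_i\to\mathbf{A}_j$ a homomorphism for $i\leq j$, $f_{i,i}=\mathrm{id}$, and $f_{j,k}\circ f_{i,j}=f_{i,k}$ for $i\leq j\leq k$. A morphism $u\colon\mathcal{A}\to((\mathbf{B}_i)_{i\in I},(g_{i,j})_{i\leq j})$ of $\mathbf{I}$-inductive systems is a family of homomorphisms $u_i\colon\mathbf{A}_i\to\mathbf{B}_i$ with $u_j\circ f_{i,j}=g_{i,j}\circ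 u_i$ for $i\leq j$. For $\xi\colon\mathbf{I}\to\mathbf{P}$ in $\mathsf{Ssl}$ and a $\mathbf{P}$-inductive system $\mathcal{B}=((\mathbf{B}_p)_{p\in P},(g_{p,q})_{p\leq q})$, put $\mathcal{B}_\xi=((\mathbf{B}_{\xi(i)})_{i\in I},(g_{\xi(i),\xi(j)})_{i\leq j})$. The category $\int^{\mathsf{Ssl}}\mathrm{Isys}_{\Sigma}$ (a Grothendieck construction) has as objects the pairs $(\mathbf{I},\mathcal{A})$ with $\mathbf{I}$ a sup-semilattice and $\mathcal{A}$ an $\mathbf{I}$-inductive system of $\Sigma$-algebras. A morphism $(\mathbf{I},\mathcal{A})\to(\mathbf{P},\mathcal{B})$ is a pair $(\xi,u)$ with $\xi\colon\mathbf{I}\to\mathbf{P}$ in $\mathsf{Ssl}$ and $u\colon\mathcal{A}\to\mathcal{B}_\xi$ a morphism of $\mathbf{I}$-inductive systems; composition is $(\psi,v)\circ(\xi,u)=(\psi\circ\xi,(v_{\xi(i)}\circ u_i)_{i\in I})$. The functor $\pi_{\mathrm{Isys}_{\Sigma}}\colon\int^{\mathsf{Ssl}}\mathrm{Isys}_{\Sigma}\to\mathsf{Ssl}$ sends $(\mathbf{I},\mathcal{A})$ to $\mathbf{I}$ and $(\xi,u)$ to $\xi$. Functor $L_\Sigma\colon\mathsf{Ssl}\to\int^{\mathsf{Ssl}}\mathrm{Isys}_{\Sigma}$: let $\mathbf{T}_\Sigma(\varnothing)$ be the free $\Sigma$-algebra on the empty set (the initial $\Sigma$-algebra). Then $L_\Sigma(\mathbf{I})$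 is $\mathbf{I}$ together with the constant system with all algebras $\mathbf{T}_\Sigma(\varnothing)$ and all transition homomorphisms identities, and $L_\Sigma(\xi)=(\xi,(\mathrm{id}_{\mathbf{T}_\Sigma(\varnothing)})_{i\in I})$. Functor $K_\Sigma\colon\mathsf{Ssl}\to\int^{\mathsf{Ssl}}\mathrm{Isys}_{\Sigma}$: for an element $i$ let $\mathbf{K}_{\{i\}}$ be the unique $\Sigma$-algebra with underlying set $\{i\}$. Then $K_\Sigma(\mathbf{I})$ is $\mathbf{I}$ together with the algebras $(\mathbf{K}_{\{i\}})_{i\in I}$ and the unique homomorphisms between them, and $K_\Sigma(\xi)$ is $\xi$ together with the unique homomorphisms $\mathbf{K}_{\{i\}}\to\mathbf{K}_{\{\xi(i)\}}$, $i\in I$. A triple of functors $(L,\pi,K)$ with $\pi\colon\mathsf{D}\to\mathsf{C}$ and $L,K\colon\mathsf{C}\to\mathsf{D}$ is a Lawvere adjoint cylinder if $L\dashv\pi\dashv K$ and $L$, $K$ are full and faithful; it is strong if, moreover, $\pi\circ L=\mathrm{Id}_{\mathsf{C}}$ and $\pi\circ K=\mathrm{Id}_{\mathsf{C}}$. *)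

(* Defs.v *)
From mathcomp Require Import all_boot.
From Stdlib Require Import FunctionalExtensionality ProofIrrelevance.

Set Implicit Arguments.
Unset Strict Implicit.
Unset Printing Implicit Defensive.

Record category := Category {
  Obj :> Type;
  Hom : Obj -> Obj -> Type;
  idm : forall X, Hom X X;
  compm : forall X Y Z, Hom Y Z -> Hom X Y -> Hom X Z;
  compm_idl : forall X Y (f : Hom X Y), compm (idm Y) f = f;
  compm_idr : forall X Y (f : Hom X Y), compm f (idm X) = f;
  compmA : forall X Y Z W (h : Hom Z W) (g : Hom Y Z) (f : Hom X Y),
    compm h (compm g f) = compm (compm h g) f }.

Record functor (C D : category) := Functor {
  fobj :> C -> D;
  fmap : forall X Y : C, Hom X Y -> Hom (fobj X) (fobj Y);
  fmap_id : forall X : C, fmap (idm X) = idm (fobj X);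
  fmap_comp : forall (X Y Z : C) (g : Hom Y Z) (f : Hom X Y),
    fmap (compm g f) = compm (fmap g) (fmap f) }.

Definition functor_id (C : category) : functor C C :=
  @Functor C C (fun X => X) (fun _ _ f => f)
    (fun _ => erefl) (fun _ _ _ _ _ => erefl).

Lemma functor_comp_id (C D E : category) (G : functor D E) (F : functor C D)
  (X : C) : fmap G (fmap F (idm X)) = idm (G (F X)).
Proof. by rewrite !fmap_id. Qed.

Lemma functor_comp_comp (C D E : category) (G : functor D E) (F : functor C D)
  (X Y Z : C) (g : Hom Y Z) (f : Hom X Y) :
  fmap G (fmap F (compm g f)) = compm (fmap G (fmap F g)) (fmap G (fmap F f)).
Proof. by rewrite !fmap_comp. Qed.

Definition functor_comp (C D E : category) (G : functor D E) (F : functor C D) :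
  functor C E :=
  @Functor C E (fun X => G (F X)) (fun _ _ f => fmap G (fmap F f))
    (functor_comp_id G F) (functor_comp_comp G F).

Record nat_trans (C D : category) (F G : functor C D) := NatTrans {
  component :> forall X : C, Hom (F X) (G X);
  naturality : forall (X Y : C) (f : Hom X Y),
    compm (component Y) (fmap F f) = compm (fmap G f) (component X) }.

(* [adjoint F G] is F -| G: F is the left adjoint. *)
Definition adjoint (C D : category) (F : functor C D) (G : functor D C) : Prop :=
  exists (eta : nat_trans (functor_id C) (functor_comp G F))
         (eps : nat_trans (functor_comp F G) (functor_id D)),
    (forall X : C, compm (eps (F X)) (fmap F (eta X)) = idm (F X)) /\
    (forall Y : D, compm (fmap G (eps Y)) (eta (G Y)) = idm (G Y)).

Definition full (C D : category) (F : functor C D) : Prop :=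
  forall (X Y : C) (g : Hom (F X) (F Y)), exists f : Hom X Y, fmap F f = g.

Definition faithful (C D : category) (F : functor C D) : Prop :=
  forall X Y : C, injective (@fmap C D F X Y).

Definition lawvere_adjoint_cylinder (C D : category)
  (L : functor C D) (pi : functor D C) (K : functor C D) : Prop :=
  (adjoint L pi /\ adjoint pi K) /\ (full L /\ faithful L) /\ (full K /\ faithful K).

Definition strong_lawvere_adjoint_cylinder (C D : category)
  (L : functor C D) (pi : functor D C) (K : functor C D) : Prop :=
  lawvere_adjoint_cylinder L pi K /\
  functor_comp pi L = functor_id C /\ functor_comp pi K = functor_id C.

Definition signature := nat -> Type.

Record algebra (S : signature) := Algebra {
  carrier :> Type;
  op : forall n, S n -> ('I_n -> carrier) -> carrier }.

Record alg_hom (S : signature) (A B : algebra S) := AlgHom {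
  alg_fun :> A -> B;
  alg_funP : forall n (s : S n) (a : 'I_n -> A),
    alg_fun (op s a) = op s (fun k => alg_fun (a k)) }.

Lemma alg_hom_ext (S : signature) (A B : algebra S) (f g : alg_hom A B) :
  f =1 g -> f = g.
Proof.
case: f g => f fP [g gP] /= /functional_extensionality fg.
by subst g; rewrite (proof_irrelevance _ fP gP).
Qed.

Definition alg_id (S : signature) (A : algebra S) : alg_hom A A :=
  @AlgHom S A A (fun x => x) (fun _ _ _ => erefl).

Lemma alg_compP (S : signature) (A B C : algebra S)
  (g : alg_hom B C) (f : alg_hom A B) n (s : S n) (a : 'I_n -> A) :
  g (f (op s a)) = op s (fun k => g (f (a k))).
Proof. by rewrite !alg_funP. Qed.

Definition alg_comp (S : signature) (A B C : algebra S)
  (g : alg_hom B C) (f : alg_hom A B) : alg_hom A C :=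
  @AlgHom S A C (fun x => g (f x)) (alg_compP g f).

Inductive term (S : signature) (X : Type) : Type :=
  | Var of X
  | App n of S n & ('I_n -> term S X).

Definition free_algebra (S : signature) (X : Type) : algebra S :=
  @Algebra S (term S X) (fun n s a => App s a).

Definition initial_algebra (S : signature) : algebra S :=
  free_algebra S Empty_set.

Definition singleton_algebra (S : signature) (I : Type) (i : I) : algebra S :=
  @Algebra S {j : I | j = i} (fun _ _ _ => exist _ i erefl).

Definition to_singleton (S : signature) (A : algebra S) (I : Type) (i : I) :
  alg_hom A (singleton_algebra S i) :=
  @AlgHom S A (singleton_algebra S i) (fun _ => exist _ i erefl)
    (fun _ _ _ => erefl).

Lemma singleton_algebra_eq (S : signature) (I : Type) (i : I)
  (x y : singleton_algebra S i) : x = y.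
Proof.
case: x y => [j jE] [k kE]; subst k.
by subst j.
Qed.

Lemma to_singleton_eq (S : signature) (A : algebra S) (I : Type) (i : I)
  (f g : alg_hom A (singleton_algebra S i)) : f = g.
Proof. by apply: alg_hom_ext => x; apply: singleton_algebra_eq. Qed.

Record ssl := SupSemilattice {
  ssl_car :> Type;
  ssl_le : ssl_car -> ssl_car -> Prop;
  ssl_join : ssl_car -> ssl_car -> ssl_car;
  ssl_refl : forall i, ssl_le i i;
  ssl_antisym : forall i j, ssl_le i j -> ssl_le j i -> i = j;
  ssl_trans : forall i j k, ssl_le i j -> ssl_le j k -> ssl_le i k;
  ssl_joinl : forall i j, ssl_le i (ssl_join i j);
  ssl_joinr : forall i j, ssl_le j (ssl_join i j);
  ssl_join_min : forall i j k,
    ssl_le i k -> ssl_le j k -> ssl_le (ssl_join i j) k }.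

Record ssl_hom (I P : ssl) := SslHom {
  ssl_fun :> I -> P;
  ssl_funP : forall i j : I,
    ssl_fun (ssl_join i j) = ssl_join (ssl_fun i) (ssl_fun j) }.

Lemma ssl_hom_ext (I P : ssl) (f g : ssl_hom I P) : f =1 g -> f = g.
Proof.
case: f g => f fP [g gP] /= /functional_extensionality fg.
by subst g; rewrite (proof_irrelevance _ fP gP).
Qed.

Lemma ssl_hom_le (I P : ssl) (xi : ssl_hom I P) (i j : I) :
  ssl_le i j -> ssl_le (xi i) (xi j).
Proof.
move=> ij; have <- : ssl_join i j = j.
  apply: ssl_antisym; last exact: ssl_joinr.
  by apply: ssl_join_min => //; apply: ssl_refl.
by rewrite ssl_funP; apply: ssl_joinl.
Qed.

Definition ssl_id (I : ssl) : ssl_hom I I :=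
  @SslHom I I (fun i => i) (fun _ _ => erefl).

Lemma ssl_compP (I P Q : ssl) (psi : ssl_hom P Q) (xi : ssl_hom I P) (i j : I) :
  psi (xi (ssl_join i j)) = ssl_join (psi (xi i)) (psi (xi j)).
Proof. by rewrite !ssl_funP. Qed.

Definition ssl_comp (I P Q : ssl) (psi : ssl_hom P Q) (xi : ssl_hom I P) :
  ssl_hom I Q :=
  @SslHom I Q (fun i => psi (xi i)) (ssl_compP psi xi).

Lemma ssl_comp_idl (I P : ssl) (f : ssl_hom I P) : ssl_comp (ssl_id P) f = f.
Proof. exact: ssl_hom_ext. Qed.

Lemma ssl_comp_idr (I P : ssl) (f : ssl_hom I P) : ssl_comp f (ssl_id I) = f.
Proof. exact: ssl_hom_ext. Qed.

Lemma ssl_compA (I P Q R : ssl)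
  (h : ssl_hom Q R) (g : ssl_hom P Q) (f : ssl_hom I P) :
  ssl_comp h (ssl_comp g f) = ssl_comp (ssl_comp h g) f.
Proof. exact: ssl_hom_ext. Qed.

Definition Ssl : category :=
  @Category ssl ssl_hom ssl_id ssl_comp ssl_comp_idl ssl_comp_idr ssl_compA.

(* The transition [trans h] does not depend on the proof [h] of [i <= j]:
   compose with [trans] at a proof of [j <= j], which is the identity. *)
Record ind_sys (S : signature) (I : ssl) := IndSys {
  alg :> I -> algebra S;
  trans : forall i j : I, ssl_le i j -> alg_hom (alg i) (alg j);
  trans_id : forall (i : I) (h : ssl_le i i), trans h = alg_id (alg i);
  trans_comp : forall (i j k : I)
      (hij : ssl_le i j) (hjk : ssl_le j k) (hik : ssl_le i k),
    alg_comp (trans hjk) (trans hij) = trans hik }.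

Record ind_mor (S : signature) (I : ssl) (A B : ind_sys S I) := IndMor {
  ind_fun :> forall i : I, alg_hom (A i) (B i);
  ind_funP : forall (i j : I) (h : ssl_le i j),
    alg_comp (ind_fun j) (trans A h) = alg_comp (trans B h) (ind_fun i) }.

Definition reindex (S : signature) (I P : ssl) (xi : ssl_hom I P)
  (B : ind_sys S P) : ind_sys S I :=
  @IndSys S I (fun i => B (xi i)) (fun _ _ h => trans B (ssl_hom_le xi h))
    (fun _ _ => trans_id _ _) (fun _ _ _ _ _ _ => trans_comp _ _ _ _).

Record isys (S : signature) := Isys {
  sys_index : ssl;
  system : ind_sys S sys_index }.

Record isys_hom (S : signature) (A B : isys S) := IsysHom {
  base : ssl_hom (sys_index A) (sys_index B);
  fiber : ind_mor (system A) (reindex base (system B)) }.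

Lemma isys_hom_ext (S : signature) (A B : isys S) (f g : isys_hom A B)
  (e : ssl_fun (base f) = ssl_fun (base g)) :
  (forall i, ecast xi (alg_hom (system A i) (system B (xi i))) e (fiber f i) =
             fiber g i) ->
  f = g.
Proof.
case: f g e => [[xi xiP] [u uP]] [[psi psiP] [v vP]] /= e; subst psi => /= uv.
have E := proof_irrelevance _ xiP psiP; subst psiP.
have e := functional_extensionality_dep _ _ uv; subst v.
by rewrite (proof_irrelevance _ uP vP).
Qed.

Lemma isys_idP (S : signature) (A : isys S) (i j : sys_index A) (h : ssl_le i j) :
  alg_comp (alg_id (system A j)) (trans (system A) h) =
  alg_comp (trans (reindex (ssl_id (sys_index A)) (system A)) h)
           (alg_id (system A i)).
Proof.
apply: alg_hom_ext => x /=.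
congr (trans _ _ _); exact: proof_irrelevance.
Qed.

Definition isys_id (S : signature) (A : isys S) : isys_hom A A :=
  @IsysHom S A A (ssl_id (sys_index A))
    (@IndMor S _ (system A) (reindex (ssl_id (sys_index A)) (system A))
       (fun i => alg_id (system A i)) (@isys_idP S A)).

Lemma isys_compP (S : signature) (A B C : isys S)
  (g : isys_hom B C) (f : isys_hom A B) (i j : sys_index A) (h : ssl_le i j) :
  alg_comp (alg_comp (fiber g (base f j)) (fiber f j)) (trans (system A) h) =
  alg_comp (trans (reindex (ssl_comp (base g) (base f)) (system C)) h)
           (alg_comp (fiber g (base f i)) (fiber f i)).
Proof.
apply: alg_hom_ext => x /=.
have /= -> := congr1 (fun u => alg_fun u x) (ind_funP (fiber f) h).
have /= -> := congr1 (fun u => alg_fun u (fiber f i x))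
                (ind_funP (fiber g) (ssl_hom_le (base f) h)).
congr (trans _ _ _); exact: proof_irrelevance.
Qed.

Definition isys_comp (S : signature) (A B C : isys S)
  (g : isys_hom B C) (f : isys_hom A B) : isys_hom A C :=
  @IsysHom S A C (ssl_comp (base g) (base f))
    (@IndMor S _ (system A) (reindex (ssl_comp (base g) (base f)) (system C))
       (fun i => alg_comp (fiber g (base f i)) (fiber f i)) (isys_compP g f)).

Lemma isys_comp_idl (S : signature) (A B : isys S) (f : isys_hom A B) :
  isys_comp (isys_id B) f = f.
Proof.
unshelve eapply isys_hom_ext; first exact: erefl.
by move=> i; apply: alg_hom_ext.
Qed.

Lemma isys_comp_idr (S : signature) (A B : isys S) (f : isys_hom A B) :
  isys_comp f (isys_id A) = f.
Proof.
unshelve eapply isys_hom_ext; first exact: erefl.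
by move=> i; apply: alg_hom_ext.
Qed.

Lemma isys_compA (S : signature) (A B C D : isys S)
  (h : isys_hom C D) (g : isys_hom B C) (f : isys_hom A B) :
  isys_comp h (isys_comp g f) = isys_comp (isys_comp h g) f.
Proof.
unshelve eapply isys_hom_ext; first exact: erefl.
by move=> i; apply: alg_hom_ext.
Qed.

Definition IntIsys (S : signature) : category :=
  @Category (isys S) (@isys_hom S) (@isys_id S) (@isys_comp S)
    (@isys_comp_idl S) (@isys_comp_idr S) (@isys_compA S).

Definition pi_Isys (S : signature) : functor (IntIsys S) Ssl :=
  @Functor (IntIsys S) Ssl (fun A : isys S => sys_index A)
    (fun (A B : isys S) (f : isys_hom A B) => base f)
    (fun _ => erefl) (fun _ _ _ _ _ => erefl).

Lemma alg_comp_idl (S : signature) (A B : algebra S) (f : alg_hom A B) :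
  alg_comp (alg_id B) f = f.
Proof. exact: alg_hom_ext. Qed.

Definition const_sys (S : signature) (I : ssl) : ind_sys S I :=
  @IndSys S I (fun _ => initial_algebra S)
    (fun _ _ _ => alg_id (initial_algebra S))
    (fun _ _ => erefl) (fun _ _ _ _ _ _ => alg_comp_idl _).

Definition L_obj (S : signature) (I : ssl) : isys S := Isys (const_sys S I).

Definition L_map (S : signature) (I P : ssl) (xi : ssl_hom I P) :
  isys_hom (L_obj S I) (L_obj S P) :=
  @IsysHom S (L_obj S I) (L_obj S P) xi
    (@IndMor S I (const_sys S I) (reindex xi (const_sys S P))
       (fun _ => alg_id (initial_algebra S)) (fun _ _ _ => erefl)).

Lemma L_map_id (S : signature) (I : ssl) :
  L_map S (ssl_id I) = isys_id (L_obj S I).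
Proof. by unshelve eapply isys_hom_ext; first exact: erefl. Qed.

Lemma L_map_comp (S : signature) (I P Q : ssl)
  (psi : ssl_hom P Q) (xi : ssl_hom I P) :
  L_map S (ssl_comp psi xi) = isys_comp (L_map S psi) (L_map S xi).
Proof.
unshelve eapply isys_hom_ext; first exact: erefl.
by move=> i; apply: alg_hom_ext.
Qed.

Definition L_Isys (S : signature) : functor Ssl (IntIsys S) :=
  @Functor Ssl (IntIsys S) (L_obj S) (@L_map S) (@L_map_id S) (@L_map_comp S).

Definition singleton_sys (S : signature) (I : ssl) : ind_sys S I :=
  @IndSys S I (fun i => singleton_algebra S i)
    (fun i j _ => to_singleton (singleton_algebra S i) j)
    (fun _ _ => to_singleton_eq _ _) (fun _ _ _ _ _ _ => to_singleton_eq _ _).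

Definition K_obj (S : signature) (I : ssl) : isys S := Isys (singleton_sys S I).

Definition K_map (S : signature) (I P : ssl) (xi : ssl_hom I P) :
  isys_hom (K_obj S I) (K_obj S P) :=
  @IsysHom S (K_obj S I) (K_obj S P) xi
    (@IndMor S I (singleton_sys S I) (reindex xi (singleton_sys S P))
       (fun i => to_singleton (singleton_algebra S i) (xi i))
       (fun _ _ _ => to_singleton_eq _ _)).

Lemma K_map_id (S : signature) (I : ssl) :
  K_map S (ssl_id I) = isys_id (K_obj S I).
Proof.
unshelve eapply isys_hom_ext; first exact: erefl.
by move=> i; apply: to_singleton_eq.
Qed.

Lemma K_map_comp (S : signature) (I P Q : ssl)
  (psi : ssl_hom P Q) (xi : ssl_hom I P) :
  K_map S (ssl_comp psi xi) = isys_comp (K_map S psi) (K_map S xi).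
Proof.
unshelve eapply isys_hom_ext; first exact: erefl.
by move=> i; apply: to_singleton_eq.
Qed.

Definition K_Isys (S : signature) : functor Ssl (IntIsys S) :=
  @Functor Ssl (IntIsys S) (K_obj S) (@K_map S) (@K_map_id S) (@K_map_comp S).

(* Main.v *)
(** The algebra [T(0)] is initial and every one-element algebra is terminal.
    Hence a morphism out of [L I], or into [K I], is determined by its underlying
    semilattice map, and every semilattice map lifts to exactly one such morphism.
    The units, counits, their naturality, the triangle identities, fullness and
    faithfulness are therefore all decided at the level of semilattices, where
    everything in sight is an identity. *)

From mathcomp Require Import all_boot.
From Stdlib Require Import FunctionalExtensionality ProofIrrelevance.
Require Import Defs.

Set Implicit Arguments.
Unset Strict Implicit.
Unset Printing Implicit Defensive.

Section Initial.
Variable S : signature.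

Fixpoint eval (A : algebra S) (t : term S Empty_set) : A :=
  match t with
  | Var x => match x with end
  | App n s a => op s (fun k => eval A (a k))
  end.

Definition from_initial (A : algebra S) : alg_hom (initial_algebra S) A :=
  @AlgHom S (initial_algebra S) A (eval A) (fun _ _ _ => erefl).

(** Structural induction on closed terms: there are no variables, and both maps commute with each
    operation, so agreement on the arguments suffices. *)
Lemma from_initial_eq (A : algebra S) (f g : alg_hom (initial_algebra S) A) :
  f = g.
Proof.
apply: alg_hom_ext; elim=> [[]|n s a IH].
rewrite (alg_funP f s a) (alg_funP g s a); congr (op s _).
exact: functional_extensionality.
Qed.

End Initial.

Section Cylinder.
Variable S : signature.

Lemma L_hom_ext (I : ssl) (B : isys S) (f g : isys_hom (L_obj S I) B) :
  base f =1 base g -> f = g.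
Proof.
(* The cast along [e] is never computed: the transported fibre is still a homomorphism out of the
   initial algebra. *)
move=> fg; apply: (isys_hom_ext (e := functional_extensionality _ _ fg)) => i.
exact: from_initial_eq.
Qed.

Lemma K_hom_ext (A : isys S) (P : ssl) (f g : isys_hom A (K_obj S P)) :
  base f =1 base g -> f = g.
Proof.
move=> fg; apply: (isys_hom_ext (e := functional_extensionality _ _ fg)) => i.
exact: to_singleton_eq.
Qed.

Definition L_counit (A : isys S) : isys_hom (L_obj S (sys_index A)) A :=
  @IsysHom S (L_obj S (sys_index A)) A (ssl_id _)
    (@IndMor S _ (const_sys S _) (reindex (ssl_id _) (system A))
       (fun i => from_initial (system A i)) (fun _ _ _ => from_initial_eq _ _)).

Definition K_unit (A : isys S) : isys_hom A (K_obj S (sys_index A)) :=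
  @IsysHom S A (K_obj S (sys_index A)) (ssl_id _)
    (@IndMor S _ (system A) (reindex (ssl_id _) (singleton_sys S _))
       (fun i => to_singleton (system A i) i) (fun _ _ _ => to_singleton_eq _ _)).

Lemma L_pi_adjoint : adjoint (L_Isys S) (pi_Isys S).
Proof.
unshelve eexists.
  (* [L_obj] keeps the index semilattice definitionally, so identities serve as the unit. *)
  by exists (fun I : Ssl => ssl_id I) => I P xi; apply: ssl_hom_ext.
unshelve eexists.
  by exists (fun A : IntIsys S => L_counit A) => A B f; apply: L_hom_ext.
by split=> [I|A]; [apply: L_hom_ext | apply: ssl_hom_ext].
Qed.

Lemma pi_K_adjoint : adjoint (pi_Isys S) (K_Isys S).
Proof.
unshelve eexists.
  by exists (fun A : IntIsys S => K_unit A) => A B f; apply: K_hom_ext.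
unshelve eexists.
  by exists (fun I : Ssl => ssl_id I) => I P xi; apply: ssl_hom_ext.
by split=> [A|I]; [apply: ssl_hom_ext | apply: K_hom_ext].
Qed.

Lemma L_full : full (L_Isys S).
Proof. by move=> I P g; exists (base g); apply: L_hom_ext. Qed.

Lemma L_faithful : faithful (L_Isys S).
(* The base of [L_map S f] is [f] by conversion. *)
Proof. by move=> I P f g /(congr1 (@base _ _ _)). Qed.

Lemma K_full : full (K_Isys S).
Proof. by move=> I P g; exists (base g); apply: K_hom_ext. Qed.

Lemma K_faithful : faithful (K_Isys S).
Proof. by move=> I P f g /(congr1 (@base _ _ _)). Qed.

Lemma pi_L_id : functor_comp (pi_Isys S) (L_Isys S) = functor_id Ssl.
(* Objects and arrows agree by conversion; only the proofs of the two functor laws remain to be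
   identified. *)
Proof. by congr Functor; apply: proof_irrelevance. Qed.

Lemma pi_K_id : functor_comp (pi_Isys S) (K_Isys S) = functor_id Ssl.
Proof. by congr Functor; apply: proof_irrelevance. Qed.

End Cylinder.

Theorem corollary3p8 (S : signature) :
  strong_lawvere_adjoint_cylinder (L_Isys S) (pi_Isys S) (K_Isys S).
Proof.
split; last by split; [apply: pi_L_id | apply: pi_K_id].
split; first by split; [apply: L_pi_adjoint | apply: pi_K_adjoint].
split; split; [exact: L_full | exact: L_faithful | exact: K_full |].
exact: K_faithful.
Qed.
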